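(* Let $T=\sum_{j=1}^kQ_jD^j$ be a degenerate exactly-solvable operator of order $k$, let $j_0$ be the largest $j$ for which $\deg Q_j=j$, and suppose that $T$ satisfies the condition $$b:=\min_{j\in[1,k-1]}^{+}\bigg(\frac{k-j}{k-j+\deg Q_j-\deg Q_k}\bigg)=\max_{j\in[j_0+1,k]}\bigg(\frac{j-j_0}{j-\deg Q_j}\bigg)=:d,$$ where the notation $\min^{+}$ means that the minimum is taken only over those $j$ for which $k-j+\deg Q_j-\deg Q_k$ is positive. Assume that the inequality $r_n\leq c_1(n-k+1)^{d}$ holds for some positive constant $c_1$ for all sufficiently large $n$. Then there exists a positive constant $c_0\leq c_1$ such that $r_n\geq c_0(n-k+1)^{d}$ holds for all sufficiently large $n$. Thus, if $\limsup_{n\to\infty}\frac{r_n}{n^d}\leq c_1$ for a positive constant $c_1$, then $\liminf_{n\to\infty}\frac{r_n}{n^d}\geq c_0$ for a positive constant $c_0\le c_1$.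
   Context: Here $D=d/dz$, and $[a,b]$ as a range for the index $j$ denotes integers. A degenerate exactly-solvable operator of order $k$ is a linear differential operator $T=\sum_{j=1}^{k}Q_jD^j$ with polynomial coefficients $Q_j\in\mathbb{C}[z]$, $Q_k\not\equiv 0$, such that $\deg Q_j\leq j$ for all $j$, with equality for at least one $j$, and $\deg Q_k<k$. For all sufficiently large integers $n$ there exist a unique constant $\lambda_n$ and a unique monic polynomial $p_n$ of degree $n$ with $T(p_n)=\lambda_n p_n$. For such $n$, $r_n=\max\{|z|:p_n(z)=0\}$. Minima and maxima over $j$ are taken only over those $j$ for which $Q_j$ is not identically zero. *)

(* Defs.v *)
From HB Require Import structures.
From mathcomp Require Import all_boot all_order all_algebra.
From mathcomp Require Import all_classical all_reals all_analysis.
From mathcomp.real_closed Require Import complex.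

Set Implicit Arguments.
Unset Strict Implicit.
Unset Printing Implicit Defensive.

Import Order.TTheory GRing.Theory Num.Theory.
Import numFieldNormedType.Exports.

Local Open Scope complex_scope.
Local Open Scope classical_set_scope.
Local Open Scope ring_scope.

(* [deg 0 = 0]; every use below is insensitive to this value. *)
Definition deg (C : nzRingType) (q : {poly C}) : nat := (size q).-1.

(* Only the coefficients [Q 1, ..., Q k] matter. *)
Definition diffop (R : realType) (k : nat) (Q : nat -> {poly R[i]})
    (q : {poly R[i]}) : {poly R[i]} :=
  \sum_(1 <= j < k.+1) Q j * derivn j q.

Definition degenerate_exactly_solvable (R : realType) (k : nat)
    (Q : nat -> {poly R[i]}) : Prop :=
  [/\ Q k != 0,
      (forall j, (1 <= j <= k)%N -> (deg (Q j) <= j)%N),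
      (exists2 j, (1 <= j <= k)%N & deg (Q j) = j)
    & (deg (Q k) < k)%N].

Definition top_index (R : realType) (k : nat) (Q : nat -> {poly R[i]}) : nat :=
  \max_(1 <= j < k.+1 | deg (Q j) == j) j.

Definition b_den (R : realType) (k : nat) (Q : nat -> {poly R[i]})
    (j : nat) : R :=
  k%:R - j%:R + (deg (Q j))%:R - (deg (Q k))%:R.

Definition b_ratio (R : realType) (k : nat) (Q : nat -> {poly R[i]})
    (j : nat) : R :=
  (k%:R - j%:R) / b_den k Q j.

Definition d_ratio (R : realType) (k : nat) (Q : nat -> {poly R[i]})
    (j : nat) : R :=
  (j%:R - (top_index k Q)%:R) / (j%:R - (deg (Q j))%:R).

(* The default value of each iterated min/max is one of the values being
   compared: for a degenerate exactly-solvable operator, j0 := top_index k Q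
   lies in [1, k-1] with b_den k Q j0 = k - deg (Q k) > 0, and k lies in
   [j0+1, k] with Q k != 0. *)
Definition b_exponent (R : realType) (k : nat) (Q : nat -> {poly R[i]}) : R :=
  \big[Num.min/b_ratio k Q (top_index k Q)]_(1 <= j < k |
      (Q j != 0) && (0 < b_den k Q j)) b_ratio k Q j.

Definition d_exponent (R : realType) (k : nat) (Q : nat -> {poly R[i]}) : R :=
  \big[Num.max/d_ratio k Q k]_((top_index k Q).+1 <= j < k.+1 | Q j != 0)
    d_ratio k Q j.

Definition monic_eigenpoly (R : realType) (k : nat) (Q : nat -> {poly R[i]})
    (n : nat) (q : {poly R[i]}) : Prop :=
  [/\ q \is monic, deg q = n
    & exists lambda : R[i], diffop k Q q = lambda *: q].

(* A supremum over a finite set, nonempty as soon as [q] is not constant.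
   The norm of [R[i]] is [R[i]]-valued, whence the real part. *)
Definition max_root_modulus (R : realType) (q : {poly R[i]}) : R :=
  sup [set complex.Re `|z| | z in [set z : R[i] | root q z]].

(* Main.v *)
Require Import Defs.
From HB Require Import structures.
From mathcomp Require Import all_boot all_order all_algebra.
From mathcomp Require Import all_classical all_reals all_analysis.
From mathcomp.real_closed Require Import complex.
From mathcomp Require Import ring lra zify.

Set Implicit Arguments.
Unset Strict Implicit.
Unset Printing Implicit Defensive.

Import Order.TTheory GRing.Theory Num.Theory.
Import numFieldNormedType.Exports.

Local Open Scope complex_scope.
Local Open Scope classical_set_scope.
Local Open Scope ring_scope.

(** At a point [z] whose modulus is at least that of every root of [p], each
    [z / (z - a)] with [a] a root has real part at least 1/2, so that
    [deg p * |p(z)| <= 2 |z| |p'(z)|]; this also confines the roots of [p'] to the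
    same disc, so it iterates and bounds [|p^(j)(z)|] by
    [(2|z|/(n-k+1))^(k-j) |p^(k)(z)|] for [j <= k].
    Used at a fixed [z], where [lambda_n = O(n^(k-1))], it makes [Q_k p^(k)] dominate
    the eigenvalue equation, whence [r_n -> oo].  Used at a root [z] of largest
    modulus [r], where the eigenvalue term vanishes, it gives
    [|Q_k(z)| <= sum_(j<k) |Q_j(z)| (2r/(n-k+1))^(k-j)], and comparing powers of [r]
    forces [r >= eps (n-k+1)^b]. *)

(** * Derivatives of a polynomial on and outside its root disc *)

(** After clearing [|z - a|^2], twice the left real part exceeds it by [|z|^2 - |a|^2]. *)
Lemma half_le_Re_div (C : numClosedFieldType) (z a : C) :
  `|a| <= `|z| -> z != a -> 2^-1 <= 'Re (z / (z - a)).
Proof.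
move=> le_az neq_za.
have za0 : 0 < `|z - a| ^+ 2 by rewrite exprn_gt0 // normr_gt0 subr_eq0.
have -> : 'Re (z / (z - a)) = 'Re (z * (z - a)^*) / `|z - a| ^+ 2.
  rewrite invC_norm mulrCA (ReMl (x := `|z - a| ^- 2)); first by rewrite mulrC.
  by rewrite rpredV rpredX // normr_real.
rewrite ler_pdivlMr // ReE [leRHS]mulrC ler_pM2l ?invr_gt0 ?ltr0n //.
rewrite normCK !rmorphM !rmorphB /= !conjCK.
rewrite -subr_ge0.
have -> : z * (z^* - a^*) + z^* * (z - a) - (z - a) * (z^* - a^*)
   = z * z^* - a * a^* by ring.
by rewrite -!normCK subr_ge0 lerXn2r // nnegrE normr_ge0.
Qed.

Lemma horner_deriv_prod (F : fieldType) (s : seq F) (z : F) :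
  z \notin s ->
  let q := \prod_(a <- s) ('X - a%:P) in
  q^`().[z] = q.[z] * \sum_(a <- s) (z - a)^-1.
Proof.
elim: s => [|a s IHs] /=; first by rewrite !big_nil derivC hornerC mulr0.
rewrite inE negb_or => /andP[neq_za zs]; rewrite !big_cons derivM hornerD.
rewrite !hornerM derivXsubC !hornerE IHs //.
have : z - a != 0 by rewrite subr_eq0.
move=> za0; set q := (\prod_(_ <- _) _).[z]; set S := \sum_(_ <- _) _.
by field.
Qed.

Lemma horner_deriv_lower (C : numClosedFieldType) (q : {poly C}) (z : C) :
  (forall a, root q a -> `|a| <= `|z|) ->
  (size q).-1%:R * `|q.[z]| <= 2 * `|z| * `|q^`().[z]|.
Proof.
move=> hq; have [qz0|qz0] := eqVneq q.[z] 0.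
  by rewrite qz0 normr0 mulr0 !mulr_ge0.
have q0 : q != 0 by apply: contra_neq qz0 => ->; rewrite horner0.
have [s def_q] := closed_field_poly_normal q.
have lq0 : lead_coef q != 0 by rewrite lead_coef_eq0.
have root_q a : root q a = (a \in s) by rewrite def_q rootZ // root_prod_XsubC.
have zs : z \notin s by rewrite -root_q.
have -> : (size q).-1 = size s.
  by rewrite def_q size_scale // size_prod_XsubC.
have -> : q^`().[z] = q.[z] * \sum_(a <- s) (z - a)^-1.
  by rewrite def_q derivZ !hornerZ horner_deriv_prod // mulrA.
rewrite normrM mulrCA mulrC ler_wpM2l ?normr_ge0 // -mulrA -normrM.
rewrite -ler_pdivrMl ?ltr0n //.
(* The modulus of [z q'(z) / q(z)], the sum of [z / (z - a)] over the roots, is at least its real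
   part. *)
apply: (@le_trans _ _ ('Re (z * \sum_(a <- s) (z - a)^-1))); last first.
  by rewrite (leif_Re_Creal _).
have -> : 2^-1 * (size s)%:R = \sum_(a <- s) 2^-1 :> C.
  by rewrite big_const_seq count_predT iter_addr addr0 mulr_natr.
rewrite mulr_sumr raddf_sum /= !(big_seq_cond predT).
apply: ler_sum => a /andP[a_s _]; apply: half_le_Re_div.
  by apply: hq; rewrite root_q.
by apply: contraNneq zs => ->.
Qed.

Lemma size_deriv_num (F : numDomainType) (q : {poly F}) :
  size q^`() = (size q).-1.
Proof.
have [le1|gt1] := leqP (size q) 1.
  by rewrite (size1_polyC le1) derivC size_poly0 size_polyC; case: (_ != 0).
rewrite /deriv size_poly_eq // prednK; last by case: size gt1 => [|[]].
rewrite mulrn_eq0 negb_or -lead_coefE lead_coef_eq0 -size_poly_eq0 -lt0n.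
by case: size gt1 => [|[]].
Qed.

Lemma size_derivn_num (F : numDomainType) (q : {poly F}) j :
  size q^`(j) = (size q - j)%N.
Proof.
elim: j => [|j IHj]; first by rewrite subn0.
by rewrite derivnS size_deriv_num IHj subnS.
Qed.

(** Gauss-Lucas for discs centred at 0: at a root of [q'] outside the disc, [horner_deriv_lower]
    would force [q] to vanish too. *)
Lemma deriv_root_disc (C : numClosedFieldType) (q : {poly C}) (rho : C) :
  rho \is Num.real -> (1 < size q)%N ->
  (forall a, root q a -> `|a| <= rho) ->
  forall a, root q^`() a -> `|a| <= rho.
Proof.
move=> rho_real sq hq a root_a; rewrite real_leNgt ?normr_real //.
apply/negP => lt_rho_a.
have hqa b : root q b -> `|b| <= `|a|.
  by move=> /hq /le_trans-> //; apply: ltW.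
have := horner_deriv_lower hqa.
rewrite (eqP (root_a : q^`().[a] == 0)) normr0 mulr0.
rewrite pmulr_rle0 ?ltr0n; last by case: size sq => [|[]].
rewrite normr_le0 => /hq /le_lt_trans /(_ lt_rho_a).
by rewrite ltxx.
Qed.

Lemma derivn_root_disc (C : numClosedFieldType) (q : {poly C}) (rho : C) j :
  rho \is Num.real -> (j < size q)%N ->
  (forall a, root q a -> `|a| <= rho) ->
  forall a, root q^`(j) a -> `|a| <= rho.
Proof.
move=> rho_real + hq; elim: j => [//|j IHj] lt_j.
rewrite derivnS; apply: deriv_root_disc => //; last exact: IHj (ltnW lt_j).
by rewrite size_derivn_num ltn_subRL addn1.
Qed.

(** Derivatives of order below [k] have degree at least [size q - k] and keep their roots in the
    disc, so each use of [horner_deriv_lower] trades one factor [size q - k] for one factor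
    [2|z|]. *)
Lemma derivn_lower (C : numClosedFieldType) (q : {poly C}) (z : C) k j :
  (k < size q)%N -> (j <= k)%N ->
  (forall a, root q a -> `|a| <= `|z|) ->
  (size q - k)%:R ^+ (k - j) * `|q^`(j).[z]|
    <= (2 * `|z|) ^+ (k - j) * `|q^`(k).[z]|.
Proof.
move=> lt_k le_jk hq; rewrite -{2}(subKn le_jk).
have : (k - j <= k)%N by lia.
elim: (k - j)%N => [|i IHi] le_ik; first by rewrite subn0 !expr0.
have lt_i : (k - i.+1 < size q)%N by lia.
have := horner_deriv_lower (derivn_root_disc (normr_real z) lt_i hq).
rewrite -derivnS subnSK // size_derivn_num => h.
apply: (@le_trans _ _ ((size q - k)%:R ^+ i
          * ((size q - (k - i.+1)).-1%:R * `|q^`(k - i.+1).[z]|))).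
  rewrite exprSr -mulrA ler_wpM2l ?exprn_ge0 // ler_wpM2r //.
  by rewrite ler_nat; lia.
apply: (@le_trans _ _ ((2 * `|z|) * ((size q - k)%:R ^+ i * `|q^`(k - i).[z]|))).
  by rewrite [leRHS]mulrCA ler_wpM2l ?exprn_ge0.
by rewrite exprS -[leRHS]mulrA ler_wpM2l ?mulr_ge0 // IHi // ltnW.
Qed.

(** * Nonvanishing of the derivative of order [k] *)

(** In characteristic 0 each differentiation lowers the multiplicity by exactly one: the new
    cofactor takes the value [(m - j) v(a)] at [a]. *)
Lemma derivn_mul_XsubC_exp (F : numFieldType) (q : {poly F}) (a : F) m j :
  ~~ root q a -> (j <= m)%N ->
  exists2 v, ~~ root v a & (q * ('X - a%:P) ^+ m)^`(j) = v * ('X - a%:P) ^+ (m - j).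
Proof.
move=> qa; elim: j => [|j IHj] le_jm; first by exists q; rewrite ?subn0.
have [v va ev] := IHj (ltnW le_jm).
exists (v^`() * ('X - a%:P) + v *+ (m - j)).
  rewrite /root hornerD hornerM hornerMn hornerXsubC subrr mulr0 add0r.
  by rewrite mulrn_eq0 negb_or subn_eq0 -ltnNge le_jm.
rewrite derivnS ev derivM deriv_exp derivXsubC mul1r -subnSK // exprS /=.
by rewrite mulrnAr [RHS]mulrDl mulrnAl -mulrA.
Qed.

(* Otherwise [a] is a root of multiplicity [m > k], and [Q k * q^`(k)] is the only
   term of the eigenvalue equation vanishing at [a] to order as low as [m - k]. *)
Lemma eigenpoly_derivn_neq0 (C : numClosedFieldType) k (Q : nat -> {poly C})
    (q : {poly C}) (lambda a : C) :
  (0 < k < size q)%N ->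
  \sum_(1 <= j < k.+1) Q j * q^`(j) = lambda *: q ->
  (forall b, root q b -> `|b| <= `|a|) ->
  ~~ root (Q k) a -> q^`(k).[a] != 0.
Proof.
move=> /andP[k0 lt_k] eig hq Qka.
have q0 : q != 0 by apply: contraTneq lt_k => ->; rewrite size_poly0.
have [m [u]] := multiplicity_XsubC q a; rewrite q0 /= => ua def_q.
have [le_mk|lt_km] := leqP m k.
  (* The derivative of order [m] does not vanish at [a], and [derivn_lower] passes this on to order
     [k]. *)
  have [v va] := derivn_mul_XsubC_exp ua (leqnn m).
  rewrite -def_q subnn expr0 mulr1 => ev.
  apply: contraNneq va => qk0.
  have := derivn_lower lt_k le_mk hq.
  rewrite qk0 normr0 mulr0 ev pmulr_rle0 ?normr_le0 //.
  by rewrite exprn_gt0 // ltr0n subn_gt0.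
exfalso; have [v va] := derivn_mul_XsubC_exp ua (ltnW lt_km).
rewrite -def_q => ev.
have dvdq j : (j < k)%N -> ('X - a%:P) ^+ (m - k).+1 %| q^`(j).
  move=> lt_jk; have [w _] := derivn_mul_XsubC_exp ua (ltnW (ltn_trans lt_jk lt_km)).
  by rewrite -def_q => ->; rewrite dvdp_mull // dvdp_exp2l //; lia.
suff : ('X - a%:P) ^+ (m - k).+1 %| Q k * q^`(k).
  rewrite ev mulrA exprS dvdp_mul2r ?expf_neq0 ?polyXsubC_eq0 //.
  by rewrite dvdp_XsubCl rootM (negPf Qka) (negPf va).
have -> : Q k * q^`(k) = lambda *: q - \sum_(1 <= j < k) Q j * q^`(j).
  by rewrite -eig big_nat_recr //= addrAC subrr add0r.
(* The eigenvalue term is the case of order 0, available since [0 < k]. *)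
apply: dvdp_sub; first by rewrite -mul_polyC dvdp_mull // (dvdq 0%N).
rewrite big_nat; elim/big_ind: _ => [|x y|j /andP[_ /dvdq]]; first exact: dvdp0.
  exact: dvdp_add.
exact: dvdp_mull.
Qed.

(** * Size of the eigenvalue and estimates from the eigenvalue equation *)

(** The factors have degrees at most [j] and [n - j], so only their top coefficients meet in degree
    [n]. *)
Lemma coef_mul_derivn (F : nzRingType) (q r : {poly F}) j n :
  (size q <= j.+1)%N -> (size r <= n.+1)%N -> (j <= n)%N ->
  (q * r^`(j))`_n = q`_j * r`_n *+ n ^_ j.
Proof.
move=> sq sr le_jn; rewrite coefM.
have lt_j : (j < n.+1)%N by [].
rewrite (bigD1 (Ordinal lt_j)) //= coef_derivn subnKC // mulrnAr big1 ?addr0 //.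
move=> i ne_ij; rewrite coef_derivn.
have {}ne_ij : (i != j :> nat) by apply: contra_neq ne_ij => e; apply: val_inj.
have := ltn_ord i; case: (ltngtP i j) ne_ij => // [lt_ij|lt_ji] _ lt_in.
  have -> : r`_(j + (n - i)) = 0 by apply/nth_default/(leq_trans sr); lia.
  by rewrite mul0rn mulr0.
have -> : q`_i = 0 by apply/nth_default/(leq_trans sq); lia.
by rewrite mul0r.
Qed.

Lemma eigenvalue_coef (C : nzRingType) k (Q : nat -> {poly C}) (q : {poly C})
    (lambda : C) n :
  q \is monic -> size q = n.+1 -> (k <= n)%N ->
  (forall j, (1 <= j <= k)%N -> (size (Q j) <= j.+1)%N) ->
  \sum_(1 <= j < k.+1) Q j * q^`(j) = lambda *: q ->
  lambda = \sum_(1 <= j < k.+1) (Q j)`_j *+ n ^_ j.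
Proof.
move=> mq sq le_kn hQ /(congr1 (fun r : {poly C} => r`_n)).
have qn : q`_n = 1 by move: mq; rewrite monicE /lead_coef sq => /eqP.
rewrite coefZ qn mulr1 => <-; rewrite coef_sum.
apply: eq_big_nat => j; rewrite ltnS => hj; rewrite coef_mul_derivn ?qn ?mulr1 ?sq //.
  exact: hQ.
by apply: leq_trans le_kn; case/andP: hj.
Qed.

(** The term of order [k] is isolated and the lower derivatives are compared with it by
    [derivn_lower]. The eigenvalue term is kept so that [z] may be a root or not. *)
Lemma eigenpoly_derivn_bound (C : numClosedFieldType) k (Q : nat -> {poly C})
    (q : {poly C}) (lambda z : C) :
  (0 < k < size q)%N ->
  \sum_(1 <= j < k.+1) Q j * q^`(j) = lambda *: q ->
  (forall b, root q b -> `|b| <= `|z|) ->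
  `|(Q k).[z]| * `|q^`(k).[z]| <= `|lambda| * `|q.[z]|
     + (\sum_(1 <= j < k) `|(Q j).[z]| * (2 * `|z| / (size q - k)%:R) ^+ (k - j))
       * `|q^`(k).[z]|.
Proof.
move=> /andP[k0 lt_k] eig hq; set w := 2 * _ / _.
have eQk : (Q k).[z] * q^`(k).[z] = lambda * q.[z]
     - \sum_(1 <= j < k) (Q j).[z] * q^`(j).[z].
  rewrite -(hornerZ lambda) -eig big_nat_recr //= hornerD hornerM horner_sum.
  by rewrite (eq_bigr _ (fun j _ => hornerM (Q j) _ z)) addrAC subrr add0r.
rewrite -normrM eQk (le_trans (ler_normB _ _)) // normrM lerD2l.
rewrite (le_trans (ler_norm_sum _ _ _)) // mulr_suml ler_sum_nat // => j /andP[_ lt_jk].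
rewrite normrM -mulrA ler_wpM2l // expr_div_n mulrAC ler_pdivlMr.
  by rewrite mulrC derivn_lower // ltnW.
by rewrite exprn_gt0 // ltr0n subn_gt0.
Qed.

Lemma leq_ffact_expn n j : (n ^_ j <= n ^ j)%N.
Proof.
elim: j => [//|j IHj]; rewrite ffactnSr expnSr; exact: leq_mul IHj (leq_subr _ _).
Qed.

(* At a point of fixed modulus the term [Q k * q^`(k)] dominates all others, as
   [lambda = O(n ^ k.-1)], so it cannot lie outside the root disc for large [n]. *)
Lemma eigenpoly_outside_bound (C : numClosedFieldType) k (Q : nat -> {poly C}) (z : C) :
  (0 < k)%N ->
  (forall j, (1 <= j <= k)%N -> (size (Q j) <= j.+1)%N) -> (size (Q k) <= k)%N ->
  exists K : C, forall n (q : {poly C}) (lambda : C),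
    (2 * k <= n)%N -> q \is monic -> size q = n.+1 ->
    \sum_(1 <= j < k.+1) Q j * q^`(j) = lambda *: q ->
    (forall b, root q b -> `|b| <= `|z|) -> ~~ root q z ->
    (n - k).+1%:R * `|(Q k).[z]| <= K.
Proof.
move=> k0 hQ hQk; pose w : C := 2 * `|z|.
(* With [N = n - k + 1], the first summand comes from [|lambda| = O(N^(k-1))] and
   [|q(z)| <= (w/N)^k D], where [D] is the modulus of the derivative of order [k]; the second from
   [N (w/N)^(k-j) <= w^(k-j)]. *)
exists ((\sum_(1 <= j < k) `|(Q j)`_j|) * 2 ^+ k.-1 * w ^+ k
        + \sum_(1 <= j < k) `|(Q j).[z]| * w ^+ (k - j)).
move=> n q lambda le_kn mq sq eig hq qz.
have lt_k : (0 < k < size q)%N by rewrite sq k0 ltnS; lia.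
have w0 : 0 <= w by rewrite mulr_ge0.
have := eigenpoly_derivn_bound lt_k eig hq; rewrite -/w.
have := derivn_lower (proj2 (andP lt_k)) (leq0n k) hq; rewrite -/w derivn0 subn0.
have -> : (size q - k)%N = (n - k).+1 by rewrite sq subSn //; lia.
set N := (n - k).+1; set D := `|q^`(k).[z]| => le_qD.
have N0 : 0 < N%:R :> C by rewrite ltr0n.
have Nk0 i : 0 < N%:R ^+ i :> C by rewrite exprn_gt0.
have D0 : 0 < D.
  rewrite lt_neqAle normr_ge0 andbT eq_sym; apply: contraNneq qz => D0.
  by move: le_qD; rewrite D0 mulr0 pmulr_rle0 // normr_le0.
have {}le_qD : `|q.[z]| <= w ^+ k / N%:R ^+ k * D.
  by rewrite mulrAC ler_pdivlMr // mulrC.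
move=> /le_trans/(_ (lerD (ler_wpM2l (normr_ge0 lambda) le_qD) (lexx _))).
rewrite mulrA -mulrDl ler_pM2r // => le_Qk.
apply: le_trans (ler_wpM2l (ltW N0) le_Qk) _; rewrite mulrDr lerD //.
  have le_lambda : `|lambda| <= (\sum_(1 <= j < k) `|(Q j)`_j|) * (2 * N%:R) ^+ k.-1.
    rewrite (eigenvalue_coef mq sq _ hQ eig); last by lia.
    (* [Q k] has degree below [k], so the top term drops and one power of [n] is saved. *)
    rewrite big_nat_recr //= [(Q k)`_k]nth_default // mul0rn addr0.
    rewrite (le_trans (ler_norm_sum _ _ _)) // mulr_suml.
    apply: ler_sum_nat => j /andP[j1 lt_jk].
    rewrite normrMn -[leLHS]mulr_natr ler_wpM2l // -natrM -natrX ler_nat.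
    apply: (@leq_trans (n ^ j)); first exact: leq_ffact_expn.
    (* [2 * k <= n] gives [n <= 2 * N]. *)
    apply: (@leq_trans ((2 * N) ^ j)); first by rewrite leq_exp2r // /N; lia.
    by rewrite leq_pexp2l // /N; lia.
  have Nk : N%:R ^+ k = N%:R * N%:R ^+ k.-1 :> C by rewrite -exprS prednK.
  rewrite mulrCA.
  apply: le_trans (ler_wpM2r _ le_lambda) _.
    by rewrite !mulr_ge0 ?invr_ge0 ?exprn_ge0 // ltW.
  rewrite exprMn Nk.
  have Nk1 : N%:R ^+ k.-1 != 0 :> C by rewrite gt_eqF.
  rewrite le_eqVlt; apply/orP; left; apply/eqP; field.
  by rewrite Nk1 gt_eqF.
rewrite mulr_sumr; apply: ler_sum_nat => j /andP[j1 lt_jk].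
rewrite mulrCA ler_wpM2l // expr_div_n mulrCA ler_piMr ?exprn_ge0 //.
rewrite ler_pdivrMr // mul1r -[leLHS]expr1 ler_weXn2l ?ler1n //.
by rewrite subn_gt0.
Qed.

(** * Growth of a polynomial far from the origin *)

Lemma horner_norm_le (F : numDomainType) (q : {poly F}) (z : F) :
  1 <= `|z| -> `|q.[z]| <= (\sum_(i < size q) `|q`_i|) * `|z| ^+ (size q).-1.
Proof.
move=> z1; rewrite horner_coef (le_trans (ler_norm_sum _ _ _)) // mulr_suml.
apply: ler_sum => i _; rewrite normrM normrX ler_wpM2l // ler_weXn2l //.
by case: i => i /=; case: size.
Qed.

(** Once [|z| >= 2|a|] for every root [a], each linear factor has modulus at least [|z|/2]. Summing
    the [2|a|] in the threshold suits the induction on the list of roots. *)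
Lemma horner_norm_ge (C : numClosedFieldType) (q : {poly C}) :
  q != 0 -> exists c M : C, [/\ 0 < c, 1 <= M &
    forall z, M <= `|z| -> c * `|z| ^+ (size q).-1 <= `|q.[z]|].
Proof.
move=> q0; have [s def_q] := closed_field_poly_normal q.
have lq0 : lead_coef q != 0 by rewrite lead_coef_eq0.
have -> : (size q).-1 = size s by rewrite def_q size_scale // size_prod_XsubC.
exists (`|lead_coef q| / 2 ^+ size s), (1 + \sum_(a <- s) 2 * `|a|); split.
- by rewrite divr_gt0 ?normr_gt0 // exprn_gt0 // ltr0n.
- by rewrite lerDl sumr_ge0 // => a _; rewrite mulr_ge0.
move=> z.
have -> : q.[z] = lead_coef q * (\prod_(a <- s) ('X - a%:P)).[z].
  by rewrite {1}def_q hornerZ.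
rewrite normrM -mulrA ler_pM2l ?normr_gt0 //.
elim: s {def_q} => [|a s IHs]; first by rewrite !big_nil hornerC normr1 !expr0 invr1 mulr1.
rewrite !big_cons hornerM hornerXsubC normrM => hz /=.
have S0 : 0 <= \sum_(a <- s) 2 * `|a| by apply: sumr_ge0 => b _; rewrite mulr_ge0.
have a0 : 0 <= `|a| by [].
have -> : (2 ^+ (size s).+1)^-1 * `|z| ^+ (size s).+1
   = (2^-1 * `|z|) * ((2 ^+ size s)^-1 * `|z| ^+ size s).
  by rewrite !exprS invfM; ring.
apply: ler_pM.
- by rewrite mulr_ge0 ?invr_ge0.
- by rewrite mulr_ge0 ?invr_ge0 ?exprn_ge0.
- apply: le_trans (lerB_dist _ _); rewrite lerBrDr -lerBrDl.
  rewrite -(ler_pM2l (ltr0n C 2)).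
  have -> : 2 * (`|z| - 2^-1 * `|z|) = `|z| by field.
  apply: le_trans hz; rewrite -subr_ge0.
  have -> : 1 + (2 * `|a| + \sum_(b <- s) 2 * `|b|) - 2 * `|a|
          = 1 + \sum_(b <- s) 2 * `|b| by ring.
  exact: addr_ge0.
apply: IHs; apply: le_trans hz; rewrite lerD2l lerDr.
exact: mulr_ge0.
Qed.

(** * Lower bound for the largest root modulus *)

(** [t] stands for [N^b] with [N = n - k + 1]; its hypothesis expresses [b <= (k - j) / e] by
    integer powers. If [|a| < eps t], the terms with [j < k] add up to at most [eps S |a|^deg(Q k)],
    too little for [|Q_k(a)| >= c |a|^deg(Q k)]. *)
Lemma max_root_lower (C : numClosedFieldType) k (Q : nat -> {poly C}) :
  (0 < k)%N -> Q k != 0 ->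
  exists eps M B : C, [/\ 0 < eps, 1 <= M, 0 < B &
  forall n (q : {poly C}) (lambda a t : C),
    (k <= n)%N -> size q = n.+1 ->
    \sum_(1 <= j < k.+1) Q j * q^`(j) = lambda *: q ->
    root q a -> (forall b, root q b -> `|b| <= `|a|) ->
    M <= `|a| -> B <= (n - k).+1%:R -> 0 <= t ->
    (forall j e, (1 <= j < k)%N -> Q j != 0 -> (0 < e)%N ->
       ((size (Q j)).-1 + (k - j) = (size (Q k)).-1 + e)%N ->
       t ^+ e <= (n - k).+1%:R ^+ (k - j)) ->
    eps * t <= `|a|].
Proof.
move=> k0 Qk0; have [c [M [c0 M1 lowQ]]] := horner_norm_ge Qk0.
pose S : C := 2 ^+ k * \sum_(1 <= j < k) \sum_(i < size (Q j)) `|(Q j)`_i|.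
have S0 : 0 <= S.
  by rewrite mulr_ge0 ?exprn_ge0 // sumr_ge0 // => j _; apply: sumr_ge0.
have cS0 : 0 < c + (1 + S) by rewrite addr_gt0 // ltr_pwDl.
(* Chosen so that [eps <= 1] and [eps * S < c]. *)
pose eps := c / (c + (1 + S)).
have eps0 : 0 < eps by rewrite divr_gt0.
have eps1 : eps <= 1 by rewrite ler_pdivrMr // mul1r lerDl addr_ge0.
have epsS : eps * S < c.
  rewrite /eps mulrAC ltr_pdivrMr // ltr_pM2l //.
  by rewrite addrA ltrDr addr_gt0.
move: (eps) eps0 eps1 epsS => {cS0}{}eps eps0 eps1 epsS.
exists eps, M, eps^-1; split=> //; first by rewrite invr_gt0.
move=> n q lambda a t le_kn sq eig qa hq Ma BN t0 ht.
rewrite real_leNgt ?ger0_real //; last by rewrite mulr_ge0 // ltW.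
apply/negP => lt_a.
have lt_k : (0 < k < size q)%N by rewrite sq k0 ltnS.
have r1 : 1 <= `|a| by apply: le_trans Ma.
have r0 : 0 < `|a| by apply: lt_le_trans r1.
(* Needed for [eigenpoly_derivn_neq0], which allows the derivative of order [k] to be cancelled. *)
have Qka : ~~ root (Q k) a.
  apply/negP => /rootP Qka; have := lowQ _ Ma.
  by rewrite Qka normr0 lt_geF // mulr_gt0 // exprn_gt0.
have D0 : 0 < `|q^`(k).[a]|.
  by rewrite normr_gt0 (eigenpoly_derivn_neq0 lt_k eig hq Qka).
have := eigenpoly_derivn_bound lt_k eig hq.
rewrite (rootP qa) normr0 mulr0 add0r ler_pM2r //.
have -> : (size q - k)%N = (n - k).+1 by rewrite sq subSn.
set N := (n - k).+1 in BN ht *.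
have N0 : 0 < N%:R :> C by rewrite ltr0n.
set T := \sum_(1 <= j < k) _ => /(le_trans (lowQ _ Ma)).
have T0 : 0 <= T.
  by apply: sumr_ge0 => j _; rewrite mulr_ge0 ?exprn_ge0 // divr_ge0 ?mulr_ge0.
have L0 : 0 <= c * `|a| ^+ (size (Q k)).-1 by rewrite mulr_ge0 ?exprn_ge0 // ltW.
apply/negP; rewrite -real_ltNge ?ger0_real // {L0 T0}/T.
apply: (@le_lt_trans _ _ (eps * S * `|a| ^+ (size (Q k)).-1)); last first.
  by rewrite ltr_pM2r ?exprn_gt0.
rewrite /S [eps * _]mulrA [leRHS]mulrAC mulr_sumr; apply: ler_sum_nat => j hj.
have /andP[j1 lt_jk] := hj.
have [->|Qj0] := eqVneq (Q j) 0.
  by rewrite horner0 normr0 mul0r !mulr_ge0 ?sumr_ge0 ?exprn_ge0 // ltW.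
rewrite [leRHS]mulrC.
apply: le_trans (ler_wpM2r _ (horner_norm_le _ r1)) _.
  by rewrite exprn_ge0 // divr_ge0 ?mulr_ge0.
rewrite -[leLHS]mulrA ler_wpM2l ?sumr_ge0 // expr_div_n exprMn.
rewrite -2!mulrA [leLHS]mulrCA [leRHS]mulrCA; apply: ler_pM.
- exact: exprn_ge0.
- by rewrite mulr_ge0 ?exprn_ge0 // divr_ge0 ?exprn_ge0.
- by rewrite ler_weXn2l ?ler1n // leq_subr.
rewrite mulrA -exprD ler_pdivrMr ?exprn_gt0 //.
(* With a positive excess [e], [|a|^e <= (eps t)^e <= eps N^(k-j)]. *)
case: (ltnP (size (Q k)).-1 ((size (Q j)).-1 + (k - j))) => [lt_e|ge_e].
  have [e0 ee] : (0 < (size (Q j)).-1 + (k - j) - (size (Q k)).-1)%N /\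
     ((size (Q j)).-1 + (k - j) = (size (Q k)).-1
       + ((size (Q j)).-1 + (k - j) - (size (Q k)).-1))%N.
    by rewrite subn_gt0 subnKC // ltnW.
  move: e0 ee; move: (_ - (size (Q k)).-1)%N => e e0 ee.
  rewrite ee exprD mulrAC mulrC ler_pM2r ?exprn_gt0 //.
  apply: (@le_trans _ _ ((eps * t) ^+ e)).
    by rewrite lerXn2r ?nnegrE ?(ltW lt_a) // mulr_ge0 // ltW.
  rewrite exprMn ler_pM ?exprn_ge0 ?(ltW eps0) //; last exact: ht ee.
  by rewrite -[leRHS]expr1 ler_wiXn2l // ltW.
(* Without excess, [|a| >= 1] bounds the power of [|a|], and the threshold [B = 1/eps] gives
   [1 <= eps N <= eps N^(k-j)]. *)
rewrite mulrAC -[leLHS]mul1r ler_pM ?exprn_ge0 //; last by rewrite ler_weXn2l.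
rewrite mulrC -ler_pdivrMr // mul1r; apply: le_trans BN _.
rewrite -[leLHS]expr1 ler_weXn2l ?ler1n //.
by rewrite subn_gt0.
Qed.

(** * Attainment of the largest root modulus over [R[i]] *)

Lemma seq_argmax disp (T : eqType) (O : orderType disp) (f : T -> O) (s : seq T) :
  s != [::] -> exists2 a, a \in s & forall b, b \in s -> (f b <= f a)%O.
Proof.
elim: s => [//|x [|y s] IHs] _.
  by exists x; rewrite ?mem_head // => b; rewrite inE => /eqP ->.
have [//|a a_s amax] := IHs.
have [le_xa|lt_ax] := leP (f x) (f a).
  exists a; first by rewrite inE a_s orbT.
  by move=> b; rewrite inE => /predU1P[->//|/amax].
exists x; first exact: mem_head.
move=> b; rewrite inE => /predU1P[->//|/amax/le_trans-> //].
exact: ltW.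
Qed.

Lemma max_root_modulusP (R : realType) (q : {poly R[i]}) :
  (1 < size q)%N -> exists a : R[i],
    [/\ root q a, `|a| = (max_root_modulus q)%:C &
        forall b, root q b -> `|b| <= `|a|].
Proof.
move=> sq; have [s def_q] := closed_field_poly_normal q.
have q0 : q != 0 by apply: contraTneq sq => ->; rewrite size_poly0.
have lq0 : lead_coef q != 0 by rewrite lead_coef_eq0.
have root_q a : root q a = (a \in s) by rewrite def_q rootZ // root_prod_XsubC.
have s0 : s != [::].
  apply: contraTneq sq => s0.
  by rewrite def_q s0 big_nil size_scale // size_poly1.
have normE (b : R[i]) : `|b| = (complex.Re `|b|)%:C by rewrite RRe_real ?normr_real.
have [a a_s amax] := seq_argmax (fun b : R[i] => complex.Re `|b|) s0.
have hub b : root q b -> complex.Re `|b| <= complex.Re `|a|.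
  by rewrite root_q; exact: amax.
exists a; split; rewrite ?root_q //; last first.
  by move=> b /hub hb; rewrite [leLHS]normE [leRHS]normE lecR.
rewrite normE; congr (_%:C); apply/le_anti/andP; split.
  apply: ub_le_sup; last by exists a; rewrite //= root_q.
  by exists (complex.Re `|a|) => _ [b /= /hub + <-].
apply: ge_sup; first by exists (complex.Re `|a|), a; rewrite //= root_q.
by move=> _ [b /= /hub + <-].
Qed.

(** * Estimates for degenerate exactly-solvable operators *)

Lemma order_gt0 (R : realType) (k : nat) (Q : nat -> {poly R[i]}) :
  degenerate_exactly_solvable k Q -> (0 < k)%N.
Proof. by case=> _ _ _; case: k. Qed.

Lemma size_coef_le (R : realType) (k : nat) (Q : nat -> {poly R[i]}) j :
  degenerate_exactly_solvable k Q ->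
  (1 <= j <= k)%N -> (size (Q j) <= j.+1)%N.
Proof. by case=> _ h _ _ /h; rewrite /deg; case: (size _). Qed.

Lemma size_lead_coef_le (R : realType) (k : nat) (Q : nat -> {poly R[i]}) :
  degenerate_exactly_solvable k Q -> (size (Q k) <= k)%N.
Proof. by case=> _ _ _; rewrite /deg; case: (size _). Qed.

Lemma monic_eigenpoly_sum (R : realType) (k : nat) (Q : nat -> {poly R[i]}) n
    (q : {poly R[i]}) :
  (k <= n)%N -> monic_eigenpoly k Q n q ->
  [/\ q \is monic, size q = n.+1 & exists lambda : R[i],
     \sum_(1 <= j < k.+1) Q j * q^`(j) = lambda *: q].
Proof.
move=> le_kn [mq dq eig]; split=> //.
by rewrite -dq /deg prednK // lt0n size_poly_eq0 monic_neq0.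
Qed.

(** One point [z] beyond [M] with [Q_k(z) != 0] serves all [n]: were all roots smaller than [M],
    [eigenpoly_outside_bound] would keep [(n-k+1) |Q_k(z)|] bounded. This secures the condition
    [M <= |a|] of [max_root_lower]. *)
Lemma max_root_modulus_unbounded (R : realType) (k : nat) (Q : nat -> {poly R[i]}) (M : R) :
  degenerate_exactly_solvable k Q ->
  \forall n \near \oo, forall q, monic_eigenpoly k Q n q -> M <= max_root_modulus q.
Proof.
move=> hT; have k0 := order_gt0 hT; have [Qk0 _ _ _] := hT.
have [c [M0 [c0 M01 lowQ]]] := horner_norm_ge Qk0.
pose z : R[i] := `|M|%:C + M0.
have M00 : 0 <= M0 by apply: le_trans M01.
have nM0 : 0 <= `|M|%:C by rewrite lecR.
have normz : `|z| = z by rewrite ger0_norm // addr_ge0.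
have z_ge : M0 <= `|z| by rewrite normz lerDr.
have Qkz : 0 < `|(Q k).[z]|.
  apply: lt_le_trans (lowQ _ z_ge); rewrite mulr_gt0 // exprn_gt0 //.
  by apply: lt_le_trans z_ge; apply: lt_le_trans M01.
have [K hK] := eigenpoly_outside_bound z k0
  (fun j => @size_coef_le _ _ _ j hT) (size_lead_coef_le hT).
have [v vE] : exists v : R, `|(Q k).[z]| = v%:C.
  by exists (complex.Re `|(Q k).[z]|); rewrite RRe_real ?normr_real.
have v0 : 0 < v by rewrite -ltcR -vE.
pose B : R := complex.Re K / v.
near=> n => q eigq.
have le_kn : (2 * k <= n)%N by near: n; exact: nbhs_infty_ge.
have le_Bn : B < (n - k).+1%:R.
  apply: (@lt_le_trans _ _ (Num.bound B)%:R); first exact: unstable.ltr_bound.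
  rewrite ler_nat leqW // leq_subRL; last by lia.
  by near: n; exact: nbhs_infty_ge.
have le_kn' : (k <= n)%N by lia.
have [mq sq [lambda eig]] := monic_eigenpoly_sum le_kn' eigq.
have sq1 : (1 < size q)%N by rewrite sq; move: k0; lia.
have [a [qa norma amax]] := max_root_modulusP sq1.
rewrite leNgt; apply/negP => lt_rM.
have lt_az : `|a| < `|z|.
  apply: lt_le_trans (_ : `|M|%:C <= _).
    by rewrite norma ltcR (lt_le_trans lt_rM) // ler_norm.
  by rewrite normz lerDl.
have hqz b : root q b -> `|b| <= `|z| by move=> /amax/le_trans-> //; apply: ltW.
have qz : ~~ root q z.
  by apply/negP => /amax /(lt_le_trans lt_az); rewrite ltxx.
have := hK n q lambda le_kn mq sq eig hqz qz.
rewrite vE -[_%:R](rmorph_nat (real_complex R)) -rmorphM lecE => /andP[_] /=.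
by rewrite -ler_pdivlMr // leNgt le_Bn.
Unshelve. all: by end_near. Qed.

(** The default entry of the maximum, at index [k], is already nonnegative. *)
Lemma d_exponent_ge0 (R : realType) (k : nat) (Q : nat -> {poly R[i]}) :
  degenerate_exactly_solvable k Q -> 0 <= d_exponent k Q.
Proof.
move=> hT; apply: le_trans (bigmax_ge_id _ _ _ _); rewrite /d_ratio divr_ge0 //.
  rewrite subr_ge0 ler_nat; apply/bigmax_leqP_seq => j.
  by rewrite mem_index_iota ltnS => /andP[].
by case: hT => _ _ _ /ltnW; rewrite subr_ge0 ler_nat.
Qed.

(** [e] equals [b_den k Q j], so [j] takes part in the minimum; the product form fits the hypothesis
    on [t] in [max_root_lower]. *)
Lemma b_exponent_le (R : realType) (k : nat) (Q : nat -> {poly R[i]}) j e :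
  (1 <= j < k)%N -> Q j != 0 -> (0 < e)%N ->
  (deg (Q j) + (k - j) = deg (Q k) + e)%N ->
  b_exponent k Q * e%:R <= (k - j)%:R.
Proof.
move=> hj Qj0 e0 ee; have /andP[_ lt_jk] := hj.
have den : b_den k Q j = e%:R.
  rewrite /b_den -natrB ?(ltnW lt_jk) //; apply/eqP.
  by rewrite subr_eq -!natrD addnC ee addnC.
have e0' : 0 < e%:R :> R by rewrite ltr0n.
rewrite -ler_pdivlMr // natrB ?(ltnW lt_jk) // -den.
apply: (@ge_bigmin_seq _ _ _ _ _ j _ (b_ratio k Q)).
  by rewrite mem_index_iota.
by rewrite Qj0 den.
Qed.

Lemma max_root_modulus_lower (R : realType) (k : nat) (Q : nat -> {poly R[i]}) :
  degenerate_exactly_solvable k Q ->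
  exists2 eps : R, 0 < eps & \forall n \near \oo, forall q,
    monic_eigenpoly k Q n q ->
    eps * (n%:R - k%:R + 1) `^ b_exponent k Q <= max_root_modulus q.
Proof.
move=> hT; have k0 := order_gt0 hT; have [Qk0 _ _ _] := hT.
have [eps [M [B [eps0 M1 B0 hlow]]]] := max_root_lower k0 Qk0.
have realE (x : R[i]) : 0 <= x -> x = (complex.Re x)%:C.
  by move=> x0; rewrite RRe_real // ger0_real.
have epsE := realE _ (ltW eps0).
have ME := realE _ (le_trans ler01 M1).
have BE := realE _ (ltW B0).
exists (complex.Re eps); first by rewrite -ltcR -epsE.
near=> n => q eigq.
have le_kn : (k <= n)%N by near: n; exact: nbhs_infty_ge.
have le_Bn : complex.Re B <= (n - k).+1%:R.
  apply: (@le_trans _ _ (Num.bound (complex.Re B))%:R); first exact/ltW/unstable.ltr_bound.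
  rewrite ler_nat leqW // leq_subRL //.
  by near: n; exact: nbhs_infty_ge.
have le_M : complex.Re M <= max_root_modulus q.
  by move: q eigq; near: n; exact: max_root_modulus_unbounded.
have [mq sq [lambda eig]] := monic_eigenpoly_sum le_kn eigq.
have sq1 : (1 < size q)%N by rewrite sq; move: k0; lia.
have [a [qa norma amax]] := max_root_modulusP sq1.
have -> : n%:R - k%:R + 1 = (n - k).+1%:R :> R by rewrite -natrB // -natr1.
set N := (n - k).+1 in le_Bn *; set b := b_exponent k Q.
rewrite -lecR rmorphM /= -epsE -norma.
(* Unification sets [t] to the real power [N^b]; then [t^e = N^(b e) <= N^(k-j)] because
   [N >= 1]. *)
apply: (hlow n q lambda) => //.
- by rewrite norma ME lecR.
- by rewrite BE -[_%:R](rmorph_nat (real_complex R)) lecR.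
- by rewrite lecR powR_ge0.
move=> j e hj Qj0 e0 ee.
rewrite -/N -(rmorph_nat (real_complex R) N) -!(rmorphXn (real_complex R)) /= lecR.
rewrite -powR_mulrn ?powR_ge0 // -powRrM -[leRHS]powR_mulrn //.
apply: ler_powR; first by rewrite ler1n.
exact: b_exponent_le.
Unshelve. all: by end_near. Qed.

(** * From the exponent [b] to [d], and to the inferior limit *)

Theorem theorem5 (R : realType) (k : nat) (Q : nat -> {poly R[i]})
    (hT : degenerate_exactly_solvable k Q)
    (hbd : b_exponent k Q = d_exponent k Q)
    (p : nat -> {poly R[i]})
    (hp : \forall n \near \oo, monic_eigenpoly k Q n (p n)) :
  let d := d_exponent k Q in
  let r := fun n : nat => max_root_modulus (p n) in
  (forall c1 : R, 0 < c1 ->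
     (\forall n \near \oo, r n <= c1 * (n%:R - k%:R + 1) `^ d) ->
     exists c0 : R, [/\ 0 < c0, c0 <= c1 &
       \forall n \near \oo, c0 * (n%:R - k%:R + 1) `^ d <= r n])
  /\
  (forall c1 : R, 0 < c1 ->
     (limn_esup (fun n : nat => (r n / n%:R `^ d)%:E) <= c1%:E)%E ->
     exists c0 : R, [/\ 0 < c0, c0 <= c1 &
       (c0%:E <= limn_einf (fun n : nat => (r n / n%:R `^ d)%:E))%E]).
Proof.
move=> d r; have d0 : 0 <= d by apply: d_exponent_ge0.
have [eps eps0 hlow] := max_root_modulus_lower hT.
have hr : \forall n \near \oo, eps * (n%:R - k%:R + 1) `^ d <= r n.
  rewrite /d -hbd; near=> n.
  have : monic_eigenpoly k Q n (p n) by near: n; exact: hp.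
  by rewrite /r; move: (p n); near: n.
split=> c1 c10 _.
  exists (Num.min eps c1); split; first by rewrite lt_min eps0.
    by rewrite ge_min lexx orbT.
  near=> n; apply: le_trans (_ : eps * (n%:R - k%:R + 1) `^ d <= _).
    by rewrite ler_wpM2r ?powR_ge0 // ge_min lexx.
  by near: n.
(* For [n >= 2k] one has [n - k + 1 >= n/2], and [d >= 0] makes the power monotone. *)
pose c := eps * 2^-1 `^ d.
have c0 : 0 < c by rewrite mulr_gt0 // powR_gt0 // invr_gt0.
exists (Num.min c c1); split; first by rewrite lt_min c0.
  by rewrite ge_min lexx orbT.
have {}hr : \forall n \near \oo, ((Num.min c c1)%:E <= (r n / n%:R `^ d)%:E)%E.
  near=> n; have n0 : (0 < n)%N by near: n; exact: nbhs_infty_gt.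
  have nd0 : 0 < n%:R `^ d :> R by rewrite powR_gt0 // ltr0n.
  have le_kn : (2 * k <= n)%N by near: n; exact: nbhs_infty_ge.
  rewrite lee_fin; apply: le_trans (_ : c <= _); first by rewrite ge_min lexx.
  rewrite ler_pdivlMr // /c -mulrA -powRM ?invr_ge0 //.
  apply: le_trans (_ : eps * (n%:R - k%:R + 1) `^ d <= _); last by near: n.
  rewrite ler_wpM2l ?(ltW eps0) // ge0_ler_powR // ?nnegrE.
  - by rewrite mulr_ge0 ?invr_ge0.
  - by rewrite addr_ge0 // subr_ge0 ler_nat; lia.
  have : (2 * k)%:R <= n%:R :> R by rewrite ler_nat.
  rewrite natrM; lra.
(* The inferior limit is the limit of the infima over tails, each at least the constant from [m]
   on. *)
case: hr => m _ hm; rewrite limn_einf_lim; apply: lime_ge; first exact: is_cvg_einfs.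
exists m => // i /= le_mi; apply: le_ereal_inf_tmp => _ [j /= le_ij <-].
by apply: hm; exact: leq_trans le_ij.
Unshelve. all: by end_near. Qed.
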